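(* Let $\mathcal{M}_1=(V,\mathcal{I}_1)$ and $\mathcal{M}_2=(V,\mathcal{I}_2)$ be matroids on a common ground set $V$ with $|V|=n$, accessible through independence oracles, and let $S\in\mathcal{I}_1\cap\mathcal{I}_2$ be a given common independent set with $|S|=r$. There is a deterministic algorithm which uses $O(nr^{2/3}\log r)$ independence queries and either determines that $S$ is a common independent set of maximum cardinality or finds an augmenting path in the exchange graph $G(S)$.
   Context: A matroid $\mathcal{M}=(V,\mathcal{I})$ consists of a finite ground set $V$ and a nonempty, downward closed family $\mathcal{I}\subseteq 2^V$ of independent sets satisfying the exchange property. An independence oracle for $\mathcal{M}_i$ answers, for a queried $X\subseteq V$, whether $X\in\mathcal{I}_i$; cost is measured in number of such queries. For a common independent set $S$, the exchange graph $G(S)$ is the directed graph on vertex set $V\cup\{s,t\}$ (with $s,t$ two new vertices), bipartite between $S$ and $\bar S=V\setminus S$, with edges: $(s,v)$ for $v\in\bar S$ iff $S\cup\{v\}\in\mathcal{I}_1$; $(v,t)$ for $v\in\bar S$ iff $S\cup\{v\}\in\mathcal{I}_2$; $(u,v)$ for $u\in S,v\in\bar S$ iff $(S\setminus\{u\})\cup\{v\}\in\mathcal{I}_1$; $(v,u)$ for $v\in\bar S,u\in S$ iff $(S\setminus\{u\})\cup\{v\}\in\mathcal{I}_2$. Viewing a path as a sequence of vertices, an $(s,t)$-path $p$ is chordless if no proper subsequence of $p$ is also an $(s,t)$-path; a chordless $(s,t)$-path in $G(S)$ is called an augmenting path. *)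

(* Defs.v *)
From mathcomp Require Import all_boot.

Set Implicit Arguments.
Unset Strict Implicit.
Unset Printing Implicit Defensive.

Record matroid (V : finType) := Matroid {
  indep : {set {set V}};
  matroid_nonempty : indep != set0;
  matroid_downward : forall X Y : {set V},
    X \subset Y -> Y \in indep -> X \in indep;
  matroid_exchange : forall X Y : {set V},
    X \in indep -> Y \in indep -> #|X| < #|Y| ->
    exists2 y, y \in Y :\: X & y |: X \in indep }.

Definition common_indep (V : finType) (M1 M2 : matroid V) (S : {set V}) : bool :=
  (S \in indep M1) && (S \in indep M2).

Definition max_common_indep (V : finType) (M1 M2 : matroid V) (S : {set V}) : Prop :=
  common_indep M1 M2 S /\
  forall T : {set V}, common_indep M1 M2 T -> #|T| <= #|S|.

(* The vertex set V ∪ {s, t} of the exchange graph: the elements of V are the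
   [inl v], and s, t are the two elements of the right summand. *)
Definition vertex (V : finType) : finType := (V + bool)%type.
Definition src (V : finType) : vertex V := inr false.
Definition snk (V : finType) : vertex V := inr true.

(* For x, y : V the two disjuncts are exclusive: the first is an edge from S to
   its complement (tested in M1), the second an edge back (tested in M2). *)
Definition exchange_edge (V : finType) (M1 M2 : matroid V) (S : {set V})
    : rel (vertex V) :=
  fun a b => match a, b with
  | inr false, inl v => (v \notin S) && (v |: S \in indep M1)
  | inl v, inr true => (v \notin S) && (v |: S \in indep M2)
  | inl x, inl y =>
      [&& x \in S, y \notin S & y |: (S :\ x) \in indep M1]
      || [&& x \notin S, y \in S & x |: (S :\ y) \in indep M2]
  | _, _ => false
  end.

Definition st_path (V : finType) (M1 M2 : matroid V) (S : {set V})
    (p : seq (vertex V)) : bool :=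
  if p is a :: q then
    [&& a == src V, last a q == snk V, uniq p
      & path (exchange_edge M1 M2 S) a q]
  else false.

Definition augmenting_path (V : finType) (M1 M2 : matroid V) (S : {set V})
    (p : seq (vertex V)) : Prop :=
  st_path M1 M2 S p /\
  forall q : seq (vertex V), subseq q p -> q != p -> ~~ st_path M1 M2 S q.

(* Deterministic adaptive query algorithms, as decision trees: [Query1 X k]
   asks whether X is independent in the first matroid and goes on with [k b],
   b being the answer; [Query2] does the same for the second matroid. The tree
   sees the matroids only through these answers. *)
Inductive query_alg (V : finType) (A : Type) : Type :=
  | Return of A
  | Query1 of {set V} & (bool -> query_alg V A)
  | Query2 of {set V} & (bool -> query_alg V A).

Fixpoint run (V : finType) (A : Type) (M1 M2 : matroid V)
    (c : query_alg V A) : A :=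
  match c with
  | Return a => a
  | Query1 X k => run M1 M2 (k (X \in indep M1))
  | Query2 X k => run M1 M2 (k (X \in indep M2))
  end.

Fixpoint queries (V : finType) (A : Type) (M1 M2 : matroid V)
    (c : query_alg V A) : nat :=
  match c with
  | Return _ => 0
  | Query1 X k => (queries M1 M2 (k (X \in indep M1))).+1
  | Query2 X k => (queries M1 M2 (k (X \in indep M2))).+1
  end.

Inductive outcome (V : finType) : Type :=
  | IsMaximum
  | Augment of seq (vertex V).

Definition correct_outcome (V : finType) (M1 M2 : matroid V) (S : {set V})
    (o : outcome V) : Prop :=
  match o with
  | IsMaximum => max_common_indep M1 M2 S
  | Augment p => augmenting_path M1 M2 S p
  end.

(* Main.v *)
(* Write [D] for the complement of [S]. One query decides whether a vertex of [D]
   has an out-neighbour (or an in-neighbour) in a given subset of [S], and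
   bisection then finds one; only vertices of [D] can be treated in this way, and
   a breadth-first search would have to test all of [D] for each vertex of [S] it
   reaches.

   Let [h] be about r^(1/3) and let [F] be the set of vertices known to be
   reachable from the source. A vertex [v] of [D] is complete if all its
   out-neighbours outside [F] are known; otherwise at least [h] of them are to be
   known. When this fails for [v], a new out-neighbour is sought among the
   vertices of [S] outside [F] that are so far known as out-neighbours of fewer
   than [tau] (about n/h) incomplete vertices. If there is none, the other
   out-neighbours of [v] are among the overloaded vertices; since these number at
   most [h^2], [v] is made complete by testing all of them. The cap [tau] on the
   load means that a vertex of [S] entering [F] spoils at most [tau] lists, so the
   maintenance takes O(n h^2 log r) queries in total.

   A backward search from the sinks and the incomplete vertices, along known edges
   out of complete vertices, now takes O(n + r log r) queries. Either it misses
   [F], and then the vertices not found form a closed set separating the source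
   from the sink, so that [S] is maximum; or it meets [F], and then [F] gains a
   sink, or an incomplete vertex together with its [h] known out-neighbours in
   [S]. The latter happens at most r/h times. *)

Require Import Defs.
From mathcomp Require Import all_boot all_order all_algebra.
From mathcomp Require Import reals exp.
From mathcomp Require Import zify ring.

Set Implicit Arguments.
Unset Strict Implicit.
Unset Printing Implicit Defensive.

(** * Query algorithms *)

Fixpoint bind (V : finType) (A B : Type) (c : query_alg V A)
    (f : A -> query_alg V B) : query_alg V B :=
  match c with
  | Return a => f a
  | Query1 X k => Query1 X (fun b => bind (k b) f)
  | Query2 X k => Query2 X (fun b => bind (k b) f)
  end.

Section Monad.
Variables (V : finType) (M1 M2 : matroid V).

Lemma run_bind A B (c : query_alg V A) (f : A -> query_alg V B) :
  run M1 M2 (bind c f) = run M1 M2 (f (run M1 M2 c)).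
Proof. by elim: c => //= X k IH. Qed.

Lemma queries_bind A B (c : query_alg V A) (f : A -> query_alg V B) :
  queries M1 M2 (bind c f) =
  queries M1 M2 c + queries M1 M2 (f (run M1 M2 c)).
Proof. by elim: c => //= X k IH; rewrite IH addSn. Qed.

Fixpoint loop (St Out : Type) (step : St -> query_alg V (St + Out)) (d : Out)
    (fuel : nat) (s : St) : query_alg V Out :=
  if fuel is m.+1 then
    bind (step s) (fun x => match x with
                            | inl s' => loop step d m s'
                            | inr o => Return V o
                            end)
  else Return V d.

(** The potential pays for the queries of each step and drops strictly, so fuel above its initial
    value cannot run out and [d] is never returned by exhaustion. *)
Lemma loopP (St Out : Type) (step : St -> query_alg V (St + Out)) (d : Out)
    (Inv : St -> Prop) (Post : Out -> Prop) (pot : St -> nat) :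
  (forall s, Inv s ->
     match run M1 M2 (step s) with
     | inl s' => [/\ Inv s', queries M1 M2 (step s) + pot s' <= pot s
                   & pot s' < pot s]
     | inr o => Post o /\ queries M1 M2 (step s) <= pot s
     end) ->
  forall fuel s, Inv s -> pot s < fuel ->
    Post (run M1 M2 (loop step d fuel s)) /\
    queries M1 M2 (loop step d fuel s) <= pot s.
Proof.
move=> stepP; elim=> // m IH s Is ltm /=; rewrite run_bind queries_bind.
have := stepP s Is; case: (run M1 M2 (step s)) => [s'|o] /=; last first.
  by case=> Po le; rewrite addn0.
case=> Is' le lt; have [|Po le'] := IH s' Is'; first exact: leq_trans lt ltm.
by split=> //; apply: leq_trans le; rewrite leq_add2l.
Qed.

Fixpoint select (q : V -> query_alg V bool) (s : seq V) : query_alg V (seq V) :=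
  if s is x :: s' then
    bind (q x) (fun b => bind (select q s')
      (fun t => Return V (if b then x :: t else t)))
  else Return V [::].

Lemma run_select q s :
  run M1 M2 (select q s) = [seq x <- s | run M1 M2 (q x)].
Proof. by elim: s => //= x s IH; rewrite !run_bind IH. Qed.

Lemma queries_select q s : (forall x, queries M1 M2 (q x) <= 1) ->
  queries M1 M2 (select q s) <= size s.
Proof.
move=> q1; elim: s => //= x s IH; rewrite !queries_bind addn0 -add1n.
exact: leq_add.
Qed.

End Monad.

(** * Bisection with a set test *)

Section Search.
Variable V : finType.

(* Bisection among the first [2 ^ k] entries of [s], one of which is known to
   satisfy the test. *)
Fixpoint bisect (test : {set V} -> query_alg V bool) (k : nat) (x0 : V)
    (s : seq V) : query_alg V V :=
  if k is k'.+1 then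
    bind (test [set x in take (2 ^ k') s]) (fun b =>
      bisect test k' x0 (if b then take (2 ^ k') s else drop (2 ^ k') s))
  else Return V (head x0 s).

Variables (M1 M2 : matroid V) (test : {set V} -> query_alg V bool).
Variables (T : {set V}) (P : pred V).
Hypothesis testE : forall X : {set V}, X \subset T ->
  run M1 M2 (test X) = [exists x in X, P x].
Hypothesis test1 : forall X : {set V}, queries M1 M2 (test X) <= 1.

Lemma bisectP k x0 s : {subset s <= T} -> size s <= 2 ^ k -> has P s ->
  (run M1 M2 (bisect test k x0 s) \in s) && P (run M1 M2 (bisect test k x0 s)).
Proof.
elim: k s => [|k IH] s sT szs /=.
  by case: s szs sT => [|x [|y s]] //= _ _; rewrite orbF inE eqxx.
rewrite run_bind testE; last by apply/subsetP=> x; rewrite inE => /mem_take/sT.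
have -> : [exists x in [set x in take (2 ^ k) s], P x] = has P (take (2 ^ k) s).
  apply/existsP/hasP=> [[x /andP[]]|[x xs Px]]; first by rewrite inE; exists x.
  by exists x; rewrite inE xs.
have : has P s = has P (take (2 ^ k) s) || has P (drop (2 ^ k) s).
  by rewrite -has_cat cat_take_drop.
move=> ->; case: ifP => [hs _|_ /= hs].
  have [||/mem_take-> ->//] := andP (IH (take (2 ^ k) s) _ _ hs).
    by move=> x /mem_take/sT.
  by rewrite size_take_min geq_minl.
have [||/mem_drop-> ->//] := andP (IH (drop (2 ^ k) s) _ _ hs).
  by move=> x /mem_drop/sT.
by rewrite size_drop leq_subLR addnn -mul2n -expnS.
Qed.

Lemma queries_bisect k x0 s : queries M1 M2 (bisect test k x0 s) <= k.
Proof.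
elim: k s => //= k IH s; rewrite queries_bind -(add1n k).
exact: leq_add.
Qed.

End Search.

(** * Matroids and the exchange graph *)

Section MatroidFacts.
Variables (V : finType) (M : matroid V) (S : {set V}).
Hypothesis SM : S \in indep M.

(** A largest independent set between [X] and [X :|: Y] works: if it were smaller than [Y], exchange
    would enlarge it. *)
Lemma indep_extend (X Y : {set V}) : X \in indep M -> Y \in indep M ->
  exists Z : {set V}, [/\ X \subset Z, Z \subset X :|: Y, Z \in indep M
                        & #|Y| <= #|Z|].
Proof.
move=> XM YM; pose P (Z : {set V}) := [&& X \subset Z, Z \subset X :|: Y & Z \in indep M].
have PX : P X by rewrite /P subxx subsetUl.
case: (arg_maxnP (fun Z : {set V} => #|Z|) PX) => Z /and3P[XZ ZXY ZM] Zmax.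
exists Z; split=> //; rewrite leqNgt; apply/negP=> ltZY.
have [y /setDP[yY yZ] yZM] := matroid_exchange ZM YM ltZY.
have := Zmax (y |: Z); rewrite /P yZM cardsU1 yZ andbT.
rewrite (subset_trans XZ (subsetUr _ _)) subUset sub1set inE yY orbT ZXY /=.
by move=> /(_ isT); rewrite add1n ltnn.
Qed.

(** Extending [v |: (S :\: X)] from [S] gives an independent subset of [v |: S] of size at least
    [#|S|]. It misses at most one element, which must lie in [X]. For empty [X] the query would test
    [v |: S] instead. *)
Lemma hitE (v : V) (X : {set V}) : v \notin S -> X \subset S -> X != set0 ->
  (v |: (S :\: X) \in indep M) = [exists u in X, v |: (S :\ u) \in indep M].
Proof.
move=> vS XS X0; apply/idP/existsP=> [vM|[u /andP[uX]]]; last first.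
  by apply: matroid_downward; rewrite setUS // setDS // sub1set.
have [Z [vZ ZS ZM leZ]] := indep_extend vM SM.
have {}ZS : Z \subset v |: S.
  apply: subset_trans ZS _; rewrite !subUset sub1set !inE eqxx subsetUr /=.
  by rewrite (subset_trans (subsetDl _ _)) ?subsetUr.
have [eqZ|neZ] := eqVneq Z (v |: S).
  have [u uX] := set0Pn _ X0; exists u; rewrite uX /=.
  by apply: matroid_downward ZM; rewrite eqZ setUS ?subD1set.
have /subsetPn[u uvS uZ] : ~~ (v |: S \subset Z).
  by apply: contra neZ => sub; rewrite eqEsubset ZS.
have uv : u != v by apply: contraNneq uZ => ->; apply: (subsetP vZ); rewrite setU11.
have uS : u \in S by move: uvS; rewrite !inE (negPf uv).
exists u; apply/andP; split.
  by apply: contraR uZ => uX; apply: (subsetP vZ); rewrite !inE uS uX orbT.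
suff -> : v |: (S :\ u) = Z by [].
apply/esym/eqP; rewrite eqEcard; apply/andP; split.
  apply/subsetP=> x xZ; have := subsetP ZS x xZ; rewrite !inE.
  have -> : x != u by apply: contraNneq uZ => <-.
  by [].
apply: leq_trans leZ; rewrite cardsU1 !inE (negPf vS) andbF /=.
by rewrite (cardsD1 u S) uS.
Qed.

End MatroidFacts.

(* Weak duality: [R] stands for the vertices reachable from the source. *)
Lemma closed_max (V : finType) (M1 M2 : matroid V) (S R : {set V}) :
  common_indep M1 M2 S ->
  (forall v, v \notin S -> v |: S \in indep M1 -> v \in R) ->
  (forall v, v \notin S -> v |: S \in indep M2 -> v \notin R) ->
  (forall u v, u \in S -> v \notin S -> u \in R ->
     v |: (S :\ u) \in indep M1 -> v \in R) ->
  (forall v u, v \notin S -> u \in S -> v \in R ->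
     v |: (S :\ u) \in indep M2 -> u \in R) ->
  max_common_indep M1 M2 S.
Proof.
move=> /andP[S1 S2] srcR snkR R1 R2; split; first exact/andP.
(* If [T :&: R] were larger than [S :&: R], exchange in [M2] and [hitE] would give an edge from some
   [y] in [R] out of [R], to [S] or to the sink. The parts outside [R] are compared in the same way
   in [M1]. *)
move=> T /andP[T1 T2]; rewrite -(cardsID R T) -(cardsID R S) leq_add //.
- rewrite leqNgt; apply/negP=> lt.
  have [y] := matroid_exchange (matroid_downward (subsetIl _ _) S2)
                (matroid_downward (subsetIl _ _) T2) lt.
  rewrite !inE => /andP[nyS /andP[yT yR]].
  have {nyS} yS : y \notin S by rewrite yR andbT in nyS.
  have -> : S :&: R = S :\: (S :\: R) by rewrite setDDr setDv set0U.
  have [->|SR0] := eqVneq (S :\: R) set0.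
    by rewrite setD0 => /(snkR _ yS); rewrite yR.
  rewrite (hitE S2) ?subsetDl // => /existsP[u /andP[/setDP[uS uR]]].
  by move=> /(R2 _ _ yS uS yR); rewrite (negPf uR).
- rewrite leqNgt; apply/negP=> lt.
  have [y] := matroid_exchange (matroid_downward (subsetDl _ _) S1)
                (matroid_downward (subsetDl _ _) T1) lt.
  rewrite !inE => /andP[nyS /andP[yR yT]].
  have {nyS} yS : y \notin S by rewrite yR in nyS.
  have -> : S :\: R = S :\: (S :&: R) by rewrite setDIr setDv set0U.
  have [->|SR0] := eqVneq (S :&: R) set0.
    by rewrite setD0 => /(srcR _ yS); rewrite (negPf yR).
  rewrite (hitE S1) ?subsetIl // => /existsP[u /andP[/setIP[uS uR]]].
  by move=> /(R1 _ _ uS yS uR); rewrite (negPf yR).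
Qed.

(** * Searching neighbourhoods by independence queries *)

Section Oracle.
Variables (V : finType) (S : {set V}).

(* Elements of the complement of [S] are the only vertices whose neighbourhoods
   can be searched with few queries: [in1 = true] asks for an in-neighbour in
   [X], by means of [M1], and [in1 = false] for an out-neighbour. *)
Definition hit (in1 : bool) (v : V) (X : {set V}) : query_alg V bool :=
  if X == set0 then Return V false
  else (if in1 then @Query1 V bool else @Query2 V bool) (v |: (S :\: X))
         (fun b => Return V b).

Definition neighbour (k : nat) (in1 : bool) (v : V) (X : {set V}) :
    query_alg V (option V) :=
  bind (hit in1 v X) (fun b =>
    if b then bind (bisect (hit in1 v) k v (enum X)) (fun u => Return V (Some u))
    else Return V None).

Variables (M1 M2 : matroid V).
Hypothesis S12 : common_indep M1 M2 S.

Definition swap (in1 : bool) (v u : V) : bool :=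
  v |: (S :\ u) \in indep (if in1 then M1 else M2).

Lemma run_hit in1 v (X : {set V}) : v \notin S -> X \subset S ->
  run M1 M2 (hit in1 v X) = [exists u in X, swap in1 v u].
Proof.
move=> vS XS; rewrite /hit; have [->|X0] := eqVneq X set0.
  by apply/esym/existsP=> -[u]; rewrite inE.
by case/andP: S12 => S1 S2; case: in1 => /=; apply: hitE.
Qed.

Lemma queries_hit in1 v X : queries M1 M2 (hit in1 v X) <= 1.
Proof. by rewrite /hit; case: ifP => // _; case: in1. Qed.

(** The first query certifies the witness that bisection presupposes, so a failed search costs only
    that query. *)
Lemma neighbourP k in1 v (X : {set V}) : v \notin S -> X \subset S -> #|X| <= 2 ^ k ->
  match run M1 M2 (neighbour k in1 v X) with
  | Some u => [/\ u \in X, swap in1 v u & queries M1 M2 (neighbour k in1 v X) <= k.+1]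
  | None => {in X, forall u, ~~ swap in1 v u} /\
            queries M1 M2 (neighbour k in1 v X) <= 1
  end.
Proof.
move=> vS XS leX; rewrite /neighbour run_bind queries_bind run_hit //.
case: ifP => [/existsP[u /andP[uX uv]]|/negbT hitN]; last first.
  rewrite /= addn0 queries_hit; split=> // u uX; apply: contra hitN => uv.
  by apply/existsP; exists u; rewrite uX.
rewrite run_bind queries_bind /= addn0 -(add1n k).
have testE (Y : {set V}) : Y \subset S -> run M1 M2 (hit in1 v Y) = [exists u in Y, swap in1 v u].
  exact: run_hit.
have [|||] := andP (bisectP testE (k := k) v (s := enum X) _ _ _).
- by move=> x; rewrite mem_enum => /(subsetP XS).
- by rewrite -cardE.
- by apply/hasP; exists u; rewrite ?mem_enum.
rewrite mem_enum => -> ->; split=> //; apply: leq_add (queries_hit _ _ _) _.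
by apply: queries_bisect => Y; apply: queries_hit.
Qed.

End Oracle.

(** * Known edges: reachability, loads and deficit *)

Section Known.
Variables (V : finType) (S A Z : {set V}).
Implicit Types (K : {set V * V}) (L : {set V}).

Definition known K : rel V := [rel x y | (x, y) \in K].

Definition reach K : {set V} :=
  locked [set y | [exists x in A, connect (known K) x y]].

Lemma reachE K y : (y \in reach K) = [exists x in A, connect (known K) x y].
Proof. by rewrite /reach -lock inE. Qed.

(* [L] will consist of the elements of the complement of [S] all of whose
   out-neighbours outside [reach K] are known. *)
Definition coreach K L : {set V} :=
  locked [set x | [exists y in Z :|: (~: S :\: L), connect (known K) x y]].

Lemma coreachE K L x :
  (x \in coreach K L) = [exists y in Z :|: (~: S :\: L), connect (known K) x y].
Proof. by rewrite /coreach -lock inE. Qed.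

Lemma sub_reach K : A \subset reach K.
Proof. by apply/subsetP=> x xA; rewrite reachE; apply/existsP; exists x; rewrite xA /=. Qed.

Lemma reach_closed K x y : (x, y) \in K -> x \in reach K -> y \in reach K.
Proof.
rewrite !reachE => xy /existsP[a /andP[aA ax]]; apply/existsP; exists a.
by rewrite aA (connect_trans ax) ?connect1.
Qed.

Lemma connect_stable K (R : {set V}) x y :
  (forall x y, (x, y) \in K -> x \in R -> y \in R) ->
  connect (known K) x y -> x \in R -> y \in R.
Proof.
move=> clR /connectP[p xp ->]; elim: p x xp => //= z p IH x /andP[xz zp] xR.
by apply: IH zp _; apply: clR xz xR.
Qed.

Lemma reach_min K (R : {set V}) : A \subset R ->
  (forall x y, (x, y) \in K -> x \in R -> y \in R) -> reach K \subset R.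
Proof.
move=> AR clR; apply/subsetP=> y; rewrite reachE => /existsP[a /andP[aA ay]].
exact: connect_stable clR ay (subsetP AR a aA).
Qed.

Lemma connect_known K K' x y : K \subset K' ->
  connect (known K) x y -> connect (known K') x y.
Proof.
move=> sub; apply: connect_sub => a b; rewrite /known /= => ab.
by apply: connect1; apply: (subsetP sub).
Qed.

Lemma reachS K K' : K \subset K' -> reach K \subset reach K'.
Proof.
move=> sub; apply/subsetP=> y; rewrite !reachE => /existsP[a /andP[aA ay]].
by apply/existsP; exists a; rewrite aA (connect_known sub).
Qed.

Lemma coreachS K K' L : K \subset K' -> coreach K L \subset coreach K' L.
Proof.
move=> sub; apply/subsetP=> x; rewrite coreachE => /existsP[a /andP[aZ ay]].
by rewrite coreachE; apply/existsP; exists a; rewrite aZ (connect_known sub).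
Qed.

Lemma coreach_closed K L x y : (x, y) \in K -> y \in coreach K L -> x \in coreach K L.
Proof.
rewrite !coreachE => xy /existsP[a /andP[aZ ya]]; apply/existsP; exists a.
by rewrite aZ (connect_trans _ ya) ?connect1.
Qed.

Lemma sub_coreach K L : Z :|: (~: S :\: L) \subset coreach K L.
Proof. by apply/subsetP=> x xZ; rewrite coreachE; apply/existsP; exists x; rewrite xZ /=. Qed.

(** The part of the list of [v] that still counts: an element entering [reach K] drops out of every
    list. *)
Definition pend K (v : V) : {set V} := [set u in S :\: reach K | (v, u) \in K].

Definition load K L (u : V) : nat := #|[set v in ~: S :\: L | (v, u) \in K]|.

Lemma pend_reach K v : v \in reach K -> pend K v = set0.
Proof.
move=> vF; apply/setP=> u; rewrite !inE; apply/negP=> /andP[/andP[uF _] vu].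
by by case/negP: uF; apply: reach_closed vu vF.
Qed.

Lemma sum_load K L (X : {set V}) :
  \sum_(u in X) load K L u =
  \sum_(v in ~: S :\: L) #|[set u in X | (v, u) \in K]|.
Proof.
rewrite /load; under eq_bigr => u _ do rewrite -sum1_card big_mkcond /=.
rewrite exchange_big /= [RHS]big_mkcond /=; apply: eq_bigr => v _.
case: ifP => vL.
  rewrite -sum1_card [LHS]big_mkcond [RHS]big_mkcond /=; apply: eq_bigr => u _.
  by rewrite in_set vL [in RHS]in_set; case: (u \in X).
by rewrite big1 // => u _; rewrite in_set vL.
Qed.

Variables (h tau : nat).

Definition deficit K L : nat := \sum_(v in ~: S :\: L) (h - #|pend K v|).

(** A vertex of [S] that becomes reached leaves at most [tau] lists of incomplete vertices, so it
    raises the deficit by at most [tau]; by double counting, the drop of the second summand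
    compensates for this. *)
Lemma deficit_grow K K' L L' : K \subset K' -> L \subset L' ->
  {in S :\: reach K, forall u, load K L u <= tau} ->
  deficit K' L' + tau * #|S :\: reach K'| <= deficit K L + tau * #|S :\: reach K|.
Proof.
move=> KK' LL' leload.
pose D := (S :\: reach K) :\: (S :\: reach K').
have sub : S :\: reach K' \subset S :\: reach K by rewrite setDS ?reachS.
have -> : #|S :\: reach K| = #|D| + #|S :\: reach K'|.
  by rewrite [#|D|]cardsDS // subnK // subset_leq_card.
rewrite mulnDr addnA leq_add2r.
apply: (@leq_trans (deficit K L + \sum_(u in D) load K L u)); last first.
  rewrite leq_add2l mulnC -sum_nat_const leq_sum // => u /setDP[uF _].
  exact: leload.
rewrite sum_load -big_split /= /deficit big_mkcond [leqRHS]big_mkcond /=.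
apply: leq_sum => v _; rewrite !inE.
case vL': (v \notin L') => //=.
have -> /= : v \notin L by apply: contra vL' => /(subsetP LL').
case: ifP => // vS.
have : #|pend K v| <= #|pend K' v| + #|[set u in D | (v, u) \in K]|.
  rewrite (leq_trans _ (leq_card_setU _ _)) // subset_leq_card //.
  apply/subsetP=> u; rewrite !inE => /andP[/andP[uF uS] vu].
  rewrite uS uF vu (subsetP KK' _ vu) /= !andbT.
  by case: (u \in reach K').
by move: #|pend K v| #|pend K' v| #|[set u in D | _]| => a b c; lia.
Qed.

End Known.

(** * Searching for a path of known edges *)

Ltac arith :=
  clear; repeat match goal with
  | |- context [@card ?T ?A] => generalize (@card T A); intro
  end; lia.

Section Search.
Variables (V : finType) (S A Z : {set V}) (h tau k : nat).
Implicit Types (K : {set V * V}) (L M : {set V}).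

Let state : Type := {set V * V} * {set V} * {set V}.

Definition avail (K : {set V * V}) (L : {set V}) (v : V) : bool :=
  [&& v \notin S, v \notin L & #|pend S A K v| < h].

Definition hits_sink (K : {set V * V}) : bool := [exists z in Z, z \in reach A K].

(* In a state [(K, L, M)], [K] is the set of known edges and [M] the set of the
   vertices all of whose in-neighbours are known to lie in [coreach K L]. *)
Definition step (s : state) : query_alg V (state + option {set V * V}) :=
  let: (K, L, M) := s in
  if hits_sink K then Return V (inr (Some K))
  else if [pick v | avail K L v] is Some v then
    bind (neighbour S k false v [set u in S :\: reach A K
                           | ((v, u) \notin K) && (load S K L u < tau)])
      (fun o => if o is Some u then Return V (inl ((v, u) |: K, L, set0)) else
        bind (select (fun u => hit S false v [set u])
                (enum [set u in S :\: reach A K | tau <= load S K L u]))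
          (fun us => Return V (inl (K :|: [set (v, u) | u in us], v |: L, set0))))
  else if [pick v | [&& v \notin S, v \in coreach S Z K L & v \notin M]] is Some v then
    bind (neighbour S k true v (S :\: coreach S Z K L))
      (fun o => Return V (inl (
        if o is Some u then ((u, v) |: K, L, if u \in reach A K then set0 else M)
        else (K, L, v |: M))))
  else Return V (inr None).

(* Completing a vertex costs at most [h * h + 1] queries. A vertex of [S] entering
   [reach A K] raises the deficit by at most [tau], and each unit of deficit is
   paid by one search of at most [k + 1] queries. *)
Definition work (K : {set V * V}) (L : {set V}) : nat :=
  #|~: S :\: L| * (h * h).+2 + #|S :\: reach A K| * (k.+1 * tau.+1) +
  k.+1 * deficit S A h K L.

(** The cost of one backward search: a failed query marks an element outside [S], and a success, of
    at most [k.+1] queries, adds an element of [S] to [coreach]. *)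
Definition round_cost : nat := #|~: S| + k.+1 * #|S|.

(** What remains of the current backward search. While lists are still being filled, a full round is
    kept in reserve. *)
Definition phase (K : {set V * V}) (L M : {set V}) : nat :=
  if hits_sink K then 0 else if [exists v, avail K L v] then round_cost
  else #|~: S :\: M| + k.+1 * #|S :\: coreach S Z K L|.

(** Beyond the current round, one round is reserved for every [h] elements of [S] still
    unreached. *)
Definition pot (s : state) : nat :=
  let: (K, L, M) := s in
  work K L + round_cost * (#|S :\: reach A K| %/ h) + phase K L M.

Variables M1 M2 : matroid V.
Hypothesis S12 : common_indep M1 M2 S.
Hypothesis defA : A = [set v | (v \notin S) && (v |: S \in indep M1)].
Hypothesis defZ : Z = [set v | (v \notin S) && (v |: S \in indep M2)].
Hypothesis h_gt0 : 0 < h.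
Hypothesis tau_gt0 : 0 < tau.
Hypothesis le_tau : #|~: S| <= tau * h.
Hypothesis le_k : #|S| <= 2 ^ k.

Local Notation swap := (swap S M1 M2).

(** Known edges never enter [A] nor leave [Z]. Hence a known path meets [A] at most in its first
    vertex and [Z] at most in its last, which later excludes chords at the source and the sink. *)
Definition sound (K : {set V * V}) : Prop := forall x y, (x, y) \in K ->
  [&& x \in S, y \notin S, y \notin A & swap true y x] ||
  [&& x \notin S, x \notin Z, y \in S & swap false x y].

(** Sinks count as complete from the start although their out-neighbours are not recorded;
    [inv_complete] therefore excepts them. *)
Record search_inv (K : {set V * V}) (L M : {set V}) : Prop := SearchInv {
  inv_sound : sound K;
  inv_sinks : Z \subset L;
  inv_complete : forall v u, v \notin S -> v \in L -> v \notin Z -> u \in S ->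
    u \notin reach A K -> swap false v u -> (v, u) \in K;
  inv_load : {in S :\: reach A K, forall u, load S K L u <= tau};
  inv_pend : forall v, v \notin S -> v \notin L -> #|pend S A K v| <= h;
  inv_marks : forall v u, v \notin S -> v \in M -> u \in S ->
    u \notin coreach S Z K L -> ~~ swap true v u }.

Lemma sinkE v : (v \in Z) = (v \notin S) && (v |: S \in indep M2).
Proof. by rewrite defZ inE. Qed.

Lemma sourceE v : (v \in A) = (v \notin S) && (v |: S \in indep M1).
Proof. by rewrite defA inE. Qed.

(** This is [deficit_grow] multiplied by [k.+1], written without subtraction: each completed vertex
    frees [(h * h).+2], and each newly reached vertex of [S] frees [k.+1], the excess of [tau.+1]
    over [tau]. *)
Lemma work_grow K K' (L L' : {set V}) : K \subset K' -> L \subset L' ->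
  {in S :\: reach A K, forall u, load S K L u <= tau} ->
  work K' L' + (h * h).+2 * #|~: S :\: L| + k.+1 * #|S :\: reach A K| <=
  work K L + (h * h).+2 * #|~: S :\: L'| + k.+1 * #|S :\: reach A K'|.
Proof.
have arith n n' f f' d d' l t H : d' + t * f' <= d + t * f ->
    n' * H + f' * (l * t.+1) + l * d' + H * n + l * f <=
    n * H + f * (l * t.+1) + l * d + H * n' + l * f'.
  by clear; move/(leq_mul (leqnn l)); rewrite !mulnDr; nia.
by move=> KK' LL' leload; apply/arith/deficit_grow.
Qed.

Lemma phase_le K L M : phase K L M <= round_cost.
Proof.
rewrite /phase; case: ifP => // _; case: ifP => // _; rewrite leq_add //.
  by rewrite subset_leq_card ?subsetDl.
by rewrite leq_mul2l subset_leq_card ?subsetDl.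
Qed.

(** Double counting: the lists hold at most [#|~: S| * h <= tau * h * h] entries, and each
    overloaded element takes up at least [tau] of them. *)
Lemma card_overloaded K L M : search_inv K L M ->
  #|[set u in S :\: reach A K | tau <= load S K L u]| <= h * h.
Proof.
move=> I; set P := [set u in _ | _].
rewrite -(leq_pmul2l tau_gt0) mulnA; apply: (@leq_trans (#|~: S| * h)); last first.
  by rewrite leq_mul2r le_tau orbT.
apply: (@leq_trans (\sum_(u in P) load S K L u)).
  rewrite mulnC -sum_nat_const leq_sum // => u.
  by rewrite inE => /andP[].
rewrite sum_load; apply: (@leq_trans (\sum_(v in ~: S :\: L) h)); last first.
  by rewrite sum_nat_const leq_mul2r subset_leq_card ?orbT ?subsetDl.
apply: leq_sum => v; rewrite !inE => /andP[vL vS].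
apply: leq_trans (inv_pend I vS vL); apply: subset_leq_card.
by apply/subsetP=> u; rewrite !inE => /andP[/andP[-> _] ->].
Qed.

(** As [reach] grows, lists and loads can only shrink, provided that no vertex left incomplete gains
    an edge. *)
Lemma inv_grow K K' (L L' M : {set V}) : search_inv K L M ->
  K \subset K' -> L \subset L' ->
  (forall v u, v \notin S -> v \notin L' -> (v, u) \in K' -> (v, u) \in K) ->
  {in S :\: reach A K', forall u, load S K' L' u <= tau} /\
  (forall v, v \notin S -> v \notin L' -> #|pend S A K' v| <= h).
Proof.
move=> I KK' LL' out; have FF' := reachS A KK'.
split=> [u /setDP[uS uF]|v vS vL'].
  have uF' : u \notin reach A K by apply: contra uF => /(subsetP FF').
  have uSF : u \in S :\: reach A K by rewrite inE uS uF'.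
  apply: leq_trans (inv_load I uSF).
  apply/subset_leq_card/subsetP=> v; rewrite !inE => /andP[/andP[vL' vS] vu].
  rewrite vS (out v u) // !andbT; apply: contra vL'; exact: (subsetP LL').
have vL : v \notin L by apply: contra vL' => /(subsetP LL').
apply: leq_trans (inv_pend I vS vL); apply/subset_leq_card/subsetP=> u.
rewrite !inE => /andP[/andP[uF uS] vu]; rewrite uS (out v u) // !andbT.
by apply: contra uF => /(subsetP FF').
Qed.

Lemma reach_add K x y : x \notin reach A K -> reach A ((x, y) |: K) = reach A K.
Proof.
move=> xF; apply/eqP; rewrite eqEsubset (reachS A (subsetUr _ K)) andbT.
apply: reach_min (sub_reach A K) _ => a b; rewrite !inE => /orP[/eqP[-> _]|].
  by rewrite (negPf xF).
exact: reach_closed.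
Qed.

Section Step.
Variables (K : {set V * V}) (L M : {set V}).
Hypothesis I : search_inv K L M.
Hypothesis no_sink : ~~ hits_sink K.

(** If [v] is unreached, its deficit drops by one; if [v] is reached, then [u] becomes reached and
    frees [k.+1]. The strict bounds on list and load leave room for the new edge. *)
Lemma step_learn v u : avail K L v -> u \in S -> u \notin reach A K ->
  (v, u) \notin K -> load S K L u < tau -> swap false v u ->
  search_inv ((v, u) |: K) L set0 /\
  work ((v, u) |: K) L + k.+1 <= work K L.
Proof.
case/and3P=> vS vL ltv uS uF vuK ltu vu; set K' := (v, u) |: K.
have KK' : K \subset K' := subsetUr _ _.
have vZ : v \notin Z by apply: contra vL => /(subsetP (inv_sinks I)).
have FF' := reachS A KK'.
split.
  split=> [x y|||x /setDP[xS xF']|w wS wL|? ?]; rewrite ?inE //.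
  - case/orP=> [/eqP[-> ->]|]; last exact: (inv_sound I).
    by rewrite vS vZ uS vu orbT.
  - exact: inv_sinks I.
  - move=> w x wS wL wZ xS xF' wx; rewrite !inE (inv_complete I) ?orbT //.
    by apply: contra xF' => /(subsetP FF').
  - have xF : x \notin reach A K by apply: contra xF' => /(subsetP FF').
    have [xu|xu] := eqVneq x u.
      rewrite xu; apply: leq_trans ltu; rewrite /load -addn1 -(cards1 v).
      apply: leq_trans (leq_card_setU _ _); apply/subset_leq_card/subsetP=> w.
      rewrite !inE => /andP[-> /orP[/eqP[->]|->]]; rewrite ?eqxx ?orbT //.
    have xSF : x \in S :\: reach A K by apply/setDP.
    apply: leq_trans (inv_load I xSF).
    apply/subset_leq_card/subsetP=> w; rewrite !inE xpair_eqE (negPf xu) andbF.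
    by [].
  - have [->|wv] := eqVneq w v.
      apply: leq_trans ltv; rewrite -addn1 -(cards1 u).
      apply: leq_trans (leq_card_setU _ _); apply/subset_leq_card/subsetP=> x.
      rewrite !inE => /andP[/andP[xF' ->] /orP[/eqP[->]|->]]; rewrite ?eqxx ?orbT //.
      by rewrite !andbT orbC; case: (x == u) => //=; apply: contra xF' => /(subsetP FF').
    apply: leq_trans (inv_pend I wS wL); apply/subset_leq_card/subsetP=> x.
    rewrite !inE xpair_eqE (negPf wv) /= => /andP[/andP[xF' ->] ->].
    by rewrite !andbT; apply: contra xF' => /(subsetP FF').
have [vF|vF] := boolP (v \in reach A K).
  have lt : #|S :\: reach A K'| < #|S :\: reach A K|.
    apply: proper_card; rewrite properE setDS //=; apply/subsetPn; exists u.
      by rewrite !inE uF.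
    rewrite !inE negb_and negbK (@reach_closed _ _ _ v) ?setU11 //.
    exact: (subsetP FF').
  have := work_grow KK' (subxx L) (inv_load I).
  have : k.+1 * (#|S :\: reach A K'|.+1) <= k.+1 * #|S :\: reach A K|.
    by rewrite leq_mul2l.
  by rewrite mulnS; arith.
rewrite /work reach_add // -addnA leq_add2l addnC -mulnS leq_mul2l /=.
rewrite /deficit (bigD1 v) /=; last by rewrite !inE vL.
rewrite [leqRHS](bigD1 v) /=; last by rewrite !inE vL.
rewrite -addSn leq_add //; last first.
  apply: leq_sum => w _; apply: leq_sub2l; apply/subset_leq_card/subsetP=> x.
  by rewrite !inE reach_add // => /andP[-> ->]; rewrite orbT.
have : #|pend S A K v| < #|pend S A K' v|.
  apply: proper_card; apply/properP; split.
    by apply/subsetP=> x; rewrite !inE reach_add // => /andP[-> ->]; rewrite orbT.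
  exists u; first by rewrite !inE reach_add // uF uS eqxx.
  by rewrite !inE (negPf vuK) andbF.
by move: ltv; arith.
Qed.

(** As [v] ceases to be incomplete, it frees [(h * h).+2], which covers the failed search and the
    tests of the overloaded elements. *)
Lemma step_complete v (us : seq V) : avail K L v ->
  {subset us <= S} -> (forall u, u \in us -> swap false v u) ->
  (forall u, u \in S -> u \notin reach A K -> swap false v u ->
     (v, u) \notin K -> u \in us) ->
  let K' := K :|: [set (v, u) | u in us] in
  search_inv K' (v |: L) set0 /\ work K' (v |: L) + (h * h).+2 <= work K L.
Proof.
case/and3P=> vS vL ltv usS us_swap us_all K'.
have KK' : K \subset K' := subsetUl _ _.
have vZ : v \notin Z by apply: contra vL => /(subsetP (inv_sinks I)).
have FF' := reachS A KK'.
have K'E x y : ((x, y) \in K') = ((x, y) \in K) || ((x == v) && (y \in us)).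
  rewrite inE; congr (_ || _); apply/imsetP/andP=> [[u uus [-> ->]]|[/eqP-> yus]].
    by rewrite eqxx.
  by exists y.
split; last first.
  have := work_grow KK' (subsetUr [set v] L) (inv_load I).
  have : k.+1 * #|S :\: reach A K'| <= k.+1 * #|S :\: reach A K|.
    by rewrite leq_mul2l subset_leq_card ?setDS ?orbT.
  have -> : #|~: S :\: L| = #|~: S :\: (v |: L)|.+1.
    rewrite (cardsD1 v) !inE vL vS add1n; congr (#|pred_of_set _|.+1).
    by apply/setP=> x; rewrite !inE negb_or andbA.
  by rewrite mulnS; arith.
have [] := inv_grow I KK' (subsetUr [set v] L).
  move=> w u wS; rewrite K'E in_setU1 negb_or => /andP[/negPf-> _].
  by rewrite orbF.
move=> lo pe; split=> // [x y|||? ? ?]; last by rewrite inE.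
- rewrite K'E => /orP[/(inv_sound I)//|/andP[/eqP-> yus]].
  by rewrite vS vZ (usS _ yus) (us_swap _ yus) orbT.
- exact: subset_trans (inv_sinks I) (subsetUr _ _).
- move=> w u wS; rewrite K'E in_setU1 => wvL wZ uS uF' wu.
  have uF : u \notin reach A K by apply: contra uF' => /(subsetP FF').
  case/orP: wvL => [/eqP wv|wL]; last by rewrite (inv_complete I).
  by rewrite wv in wu *; rewrite eqxx /=; case: (boolP ((v, u) \in K)) => //=; apply: us_all.
Qed.

Hypothesis saturated : forall v, ~~ avail K L v.

Lemma reach_complete v : v \notin S -> v \in reach A K -> v \in L.
Proof.
move=> vS vF; apply: contraR (saturated v) => vL.
by rewrite /avail vS vL pend_reach // cards0.
Qed.

(** Otherwise a sink or an incomplete vertex would be reached. The latter is impossible since its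
    list would be empty, hence shorter than [h]. *)
Lemma reach_coreach v : v \in reach A K -> v \notin coreach S Z K L.
Proof.
move=> vF; rewrite coreachE; apply/existsP=> -[w /andP[wZL vw]].
have wF : w \in reach A K := connect_stable (@reach_closed _ _ _) vw vF.
move: wZL; rewrite !inE => /orP[wZ|/andP[wL wS]].
  by case/negP: no_sink; apply/existsP; exists w; rewrite wZ.
by rewrite (reach_complete wS wF) in wL.
Qed.

(** If [u] is unreached, the round goes on with a larger [coreach], which pays [k.+1]. If [u] is
    reached, the round ends, and either a sink is reached or [h] new elements of [S] are, which
    releases the reserve for the next round. *)
Lemma step_back u v : v \notin S -> v \in coreach S Z K L -> u \in S ->
  u \notin coreach S Z K L -> swap true v u ->
  let K' := (u, v) |: K in
  search_inv K' L (if u \in reach A K then set0 else M) /\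
  work K' L + round_cost * (#|S :\: reach A K'| %/ h) + k.+1 +
    phase K' L (if u \in reach A K then set0 else M) <=
  work K L + round_cost * (#|S :\: reach A K| %/ h) + phase K L M.
Proof.
move=> vS vB uS uB vu K'.
have KK' : K \subset K' := subsetUr _ _.
have FF' := reachS A KK'.
have BB' := coreachS S Z L KK'.
have out w x : w \notin S -> (w, x) \in K' -> (w, x) \in K.
  move=> wS; rewrite !inE xpair_eqE.
  by have /negPf-> : w != u by apply: contraNneq wS => ->.
have [] := inv_grow I KK' (subxx L) (fun w x wS _ => @out w x wS).
move=> lo pe; split.
  split=> // [x y||w x|w x].
  - rewrite !inE => /orP[/eqP[-> ->]|]; last exact: (inv_sound I).
    rewrite uS vS vu /= andbT; apply/orP; left.
    (* [A] is part of [reach], hence disjoint from [coreach]; so the new edge does not enter [A]. *)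
    apply: contraL vB => vA; apply: reach_coreach.
    exact: (subsetP (sub_reach A K)).
  - exact: inv_sinks I.
  - move=> wS wL wZ xS xF' wx; rewrite !inE (inv_complete I) ?orbT //.
    by apply: contra xF' => /(subsetP FF').
  - case: ifP => _; first by rewrite inE.
    move=> wS wM xS xB'; apply: (inv_marks I) => //.
    by apply: contra xB' => /(subsetP BB').
have workK : work K' L <= work K L.
  have := work_grow KK' (subxx L) (inv_load I).
  have : k.+1 * #|S :\: reach A K'| <= k.+1 * #|S :\: reach A K|.
    by rewrite leq_mul2l subset_leq_card ?setDS ?orbT.
  arith.
have no_avail : [exists v, avail K L v] = false.
  by apply/negbTE/negP=> /existsP[w]; apply/negP.
have ltB : k.+1 * #|S :\: coreach S Z K' L| + k.+1 <= k.+1 * #|S :\: coreach S Z K L|.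
  rewrite addnC -mulnS leq_mul2l /=; apply: proper_card.
  rewrite properE setDS //=; apply/subsetPn; exists u; first by rewrite inE uB.
  rewrite !inE negb_and negbK (@coreach_closed _ _ _ _ _ u v) ?setU11 //.
  exact: (subsetP BB').
rewrite [in leqRHS]/phase (negPf no_sink) no_avail.
case: ifP => [uF|/negbT uF]; last first.
  have eqF : reach A K' = reach A K by apply: reach_add.
  have -> : phase K' L M = #|~: S :\: M| + k.+1 * #|S :\: coreach S Z K' L|.
    have sinkK' : hits_sink K' = false by rewrite /hits_sink eqF; apply: negPf no_sink.
    rewrite /phase sinkK' ifF //.
    apply/negbTE/negP=> /existsP[w /and3P[wS wL ltw]].
    case/negP: (saturated w); rewrite /avail wS wL (leq_ltn_trans _ ltw) //.
    apply/subset_leq_card/subsetP=> x; rewrite !inE eqF => /andP[-> ->].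
    by rewrite orbT.
  by move: workK ltB; rewrite eqF; move: (round_cost * _) => c; arith.
have vF' : v \in reach A K'.
  by apply: (@reach_closed _ _ _ u); rewrite ?setU11 //; apply: (subsetP FF').
(* With [u] reached, so is the end [w] of a known path from [v]: a sink, or an incomplete vertex
   with at least [h] elements in its list. *)
move: vB; rewrite coreachE => /existsP[w /andP[wZL vw]].
have wF' : w \in reach A K'.
  exact: connect_stable (@reach_closed _ A K') (connect_known KK' vw) vF'.
have [sink|no_sink'] := boolP (hits_sink K').
  rewrite /phase sink addn0.
  have : round_cost * (#|S :\: reach A K'| %/ h) <= round_cost * (#|S :\: reach A K| %/ h).
    by rewrite leq_mul2l leq_div2r ?orbT // subset_leq_card // setDS.
  move: workK ltB; arith.
have [wS wL] : w \notin S /\ w \notin L.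
  move: wZL; rewrite !inE => /orP[wZ|/andP[-> ->]] //.
  by case/negP: no_sink'; apply/existsP; exists w; rewrite wZ.
have lew : h <= #|pend S A K w|.
  by rewrite leqNgt; apply: contra (saturated w) => ltw; rewrite /avail wS wL.
have le : #|S :\: reach A K'| + h <= #|S :\: reach A K|.
  rewrite (leq_trans (leq_add (leqnn _) lew)) // addnC -leq_subRL; last first.
    by rewrite subset_leq_card //; apply/subsetP=> x; rewrite !inE => /andP[].
  rewrite -cardsDS; last by apply/subsetP=> x; rewrite !inE => /andP[].
  apply/subset_leq_card/subsetP=> x; rewrite !inE => /andP[xF' ->].
  rewrite andbT negb_and negbK; apply/andP; split; last first.
    by apply: contra xF' => /(subsetP FF').
  apply/orP; right; apply: contra xF' => wx; apply: reach_closed wF'.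
  exact: (subsetP KK').
have : round_cost * (#|S :\: reach A K'| %/ h).+1 <= round_cost * (#|S :\: reach A K| %/ h).
  rewrite leq_mul2l; have := leq_div2r h le.
  by rewrite divnDr // divnn h_gt0 addn1 => ->; rewrite orbT.
have := phase_le K' L set0.
by move: workK ltB; rewrite mulnS; arith.
Qed.

(** The complement of [coreach] is closed: along edges leaving [S] by the marks, along edges
    entering [S] because complete vertices know all their unreached out-neighbours. It contains [A]
    by [reach_coreach] and avoids [Z]. *)
Lemma step_stop :
  (forall v, ~~ [&& v \notin S, v \in coreach S Z K L & v \notin M]) ->
  max_common_indep M1 M2 S.
Proof.
move=> marked; apply: (closed_max (R := ~: coreach S Z K L) S12).
- move=> v vS vM1; rewrite inE; apply: reach_coreach.
  by apply: (subsetP (sub_reach A K)); rewrite sourceE vS.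
- move=> v vS vM2; rewrite inE negbK; apply: (subsetP (sub_coreach S Z K L)).
  by rewrite inE sinkE vS vM2.
- move=> u v uS vS; rewrite !inE => uB uv; apply: contraL uv => vB.
  apply: (inv_marks I) => //; apply: contraR (marked v) => vM.
  by rewrite vS vB vM.
- move=> v u vS uS; rewrite !inE => vB vu; apply: contra vB => uB.
  have := subsetP (sub_coreach S Z K L) v; rewrite !inE vS andbT.
  have [vZ -> //|vZ] := boolP (v \in Z).
  have [vL _|vL -> //] := boolP (v \in L).
  apply: (coreach_closed _ uB); apply: (inv_complete I) => //.
  by apply/negP=> /reach_coreach; rewrite uB.
Qed.

End Step.
End Search.

(** * Correctness and cost of the whole search *)

Section SearchLoop.
Variables (V : finType) (S A Z : {set V}) (h tau k : nat).
Variables M1 M2 : matroid V.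
Hypothesis S12 : common_indep M1 M2 S.
Hypothesis defA : A = [set v | (v \notin S) && (v |: S \in indep M1)].
Hypothesis defZ : Z = [set v | (v \notin S) && (v |: S \in indep M2)].
Hypothesis h_gt0 : 0 < h.
Hypothesis tau_gt0 : 0 < tau.
Hypothesis le_tau : #|~: S| <= tau * h.
Hypothesis le_k : #|S| <= 2 ^ k.

Local Notation pot := (pot S A Z h tau k).
Local Notation step := (step S A Z h tau k).

Definition loop_post (o : option {set V * V}) : Prop :=
  if o is Some K then sound S A Z M1 M2 K /\ hits_sink A Z K
  else max_common_indep M1 M2 S.

Lemma stepP K L M : search_inv S A Z h tau M1 M2 K L M ->
  match run M1 M2 (step (K, L, M)) with
  | inl s => [/\ let: (K', L', M') := s in search_inv S A Z h tau M1 M2 K' L' M',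
                 queries M1 M2 (step (K, L, M)) + pot s <= pot (K, L, M)
               & pot s < pot (K, L, M)]
  | inr o => loop_post o /\ queries M1 M2 (step (K, L, M)) <= pot (K, L, M)
  end.
Proof.
move=> I; rewrite /step; have [sink|no_sink] := boolP (hits_sink A Z K).
  by split=> //; split=> //; apply: inv_sound I.
case: pickP => [v av|no_av].
  have [vS vL ltv] := and3P av.
  have phaseE : phase S A Z h k K L M = round_cost S k.
    by rewrite /phase (negPf no_sink) ifT //; apply/existsP; exists v.
  have round_le (K' : {set V * V}) : K \subset K' ->
      round_cost S k * (#|S :\: reach A K'| %/ h) <=
      round_cost S k * (#|S :\: reach A K| %/ h).
    by move=> sub; rewrite leq_mul2l leq_div2r ?orbT // subset_leq_card // setDS // reachS.
  set T := [set u in _ | _].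
  have TS : T \subset S by apply/subsetP=> u; rewrite !inE => /andP[/andP[_ ->]].
  rewrite run_bind queries_bind.
  have := neighbourP S12 false vS TS (leq_trans (subset_leq_card TS) le_k).
  case: (run M1 M2 (neighbour S k false v T)) => [u [uT vu le1]|[T0 le1]].
    have /andP[/andP[uF uS] /andP[uK ltu]] : (u \notin reach A K) && (u \in S) &&
        (((v, u) \notin K) && (load S K L u < tau)) by move: uT; rewrite !inE.
    have [I' lew] := step_learn k I av uS uF uK ltu vu.
    have := round_le _ (subsetUr [set (v, u)] K).
    have := phase_le S A Z h k ((v, u) |: K) L set0.
    move: le1 lew; rewrite /= /pot phaseE addn0.
    move: (round_cost _ _) (round_cost _ _ * _) (round_cost _ _ * _) => a b c.
    by move=> e1 e2 e3 e4; split=> //; move: e1 e2 e3 e4; arith.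
  rewrite run_bind queries_bind run_select /= addn0.
  set P := [set u in _ | _]; set us := filter _ _.
  have memP u : (u \in P) = [&& u \notin reach A K, u \in S & tau <= load S K L u].
    by rewrite !inE andbA.
  have hitE1 u : u \in P -> run M1 M2 (hit S false v [set u]) = swap S M1 M2 false v u.
    rewrite memP => /and3P[_ uS _]; rewrite (run_hit S12) ?sub1set //.
    by apply/existsP/idP=> [[x /andP[/set1P->]]|vu] //; exists u; rewrite set11.
  have usE u : (u \in us) = (u \in P) && swap S M1 M2 false v u.
    rewrite mem_filter mem_enum andbC; apply: andb_id2l => uP; exact: hitE1.
  have [|||I' lew] := step_complete k I (us := us) av.
  - by move=> u; rewrite usE memP => /andP[/and3P[]].
  - by move=> u; rewrite usE => /andP[].
  (* The failed search excludes unknown out-neighbours of load below [tau]; those that remain are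
     overloaded and were tested one by one. *)
  - move=> u uS uF vu uK; rewrite usE memP uS uF vu andbT /= leqNgt.
    by apply: contraL vu => ltu; apply: T0; rewrite !inE uF uS uK.
  have leP := card_overloaded tau_gt0 le_tau I.
  have leq : queries M1 M2 (select (fun u => hit S false v [set u]) (enum P)) <= h * h.
    apply: leq_trans leP; rewrite cardE; apply: queries_select => u.
    exact: queries_hit.
  have := round_le _ (subsetUl K [set (v, u) | u in us]).
  have := phase_le S A Z h k (K :|: [set (v, u) | u in us]) (v |: L) set0.
  move: le1 leq lew; rewrite /pot phaseE.
  move: (round_cost _ _) (round_cost _ _ * _) (round_cost _ _ * _) => a b c.
  move=> e1 e2 e3 e4 e5.
  have ar q1 q2 m w w' p : q1 <= 1 -> q2 <= m -> w' + m.+2 <= w -> p <= a ->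
      q1 + q2 + (w' + c + p) <= w + b + a /\ w' + c + p < w + b + a.
    by move: e5; clear; lia.
  by have [] := ar _ _ _ _ _ _ e1 e2 e3 e4; split.
(* From here on every incomplete vertex has a list of at least [h] elements, and the backward search
   runs. *)
have sat v : ~~ avail S A h K L v by rewrite no_av.
case: pickP => [v /and3P[vS vB vM]|marked]; last first.
  split=> //; apply: (step_stop S12 defA defZ h_gt0 I no_sink sat) => v.
  by rewrite marked.
rewrite run_bind queries_bind addn0.
have := neighbourP S12 true vS (subsetDl S (coreach S Z K L))
          (leq_trans (subset_leq_card (subsetDl _ _)) le_k).
case: (run M1 M2 (neighbour S k true v _)) => [u [/setDP[uS uB] vu le1]|[T0 le1]].
  have [I' le] := step_back k h_gt0 I no_sink sat vS vB uS uB vu.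
  move: le1 le; rewrite /= /pot.
  move: (round_cost _ _ * _) (round_cost _ _ * _) => b c.
  by move=> e1 e2; split=> //; move: e1 e2; arith.
have no_avail : [exists v, avail S A h K L v] = false.
  by apply/negbTE/negP=> /existsP[w]; apply/negP.
have lt : #|~: S :\: M| = #|~: S :\: (v |: M)|.+1.
  rewrite (cardsD1 v) !inE vM vS add1n; congr (#|pred_of_set _|.+1).
  by apply/setP=> x; rewrite !inE negb_or andbA.
rewrite /= /pot /phase (negPf no_sink) no_avail lt.
have ar a x y q : q <= 1 ->
    q + (a + (x + y)) <= a + (x.+1 + y) /\ a + (x + y) < a + (x.+1 + y).
  by clear; lia.
split; [|exact: (proj1 (ar _ _ _ _ le1))|exact: (proj2 (ar _ _ _ _ le1))].
case: I => ? ? ? ? ? marks; split=> // w u wS; rewrite !inE => /orP[/eqP->|].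
  by move=> uS uB; apply: T0; rewrite inE uB.
exact: marks.
Qed.

Lemma search_inv0 : search_inv S A Z h tau M1 M2 set0 Z set0.
Proof.
split=> // [x y|v u vS vZ|u uSF|v vS vZ|v u vS]; rewrite ?inE //.
- by rewrite vZ.
- by rewrite /load eq_card0 // => v; rewrite !inE andbF.
- by rewrite /pend eq_card0 // => u; rewrite !inE andbF.
Qed.

(** The fuel exceeds the initial potential, so [None] is returned only when the search has certified
    maximality. *)
Definition search : query_alg V (option {set V * V}) :=
  let s0 := (set0, Z, set0) in loop step None (pot s0).+1 s0.

Lemma searchP :
  loop_post (run M1 M2 search) /\ queries M1 M2 search <= pot (set0, Z, set0).
Proof.
apply: (@loopP _ M1 M2 _ _ step None (fun s => let: (K, L, M) := s in
                 search_inv S A Z h tau M1 M2 K L M) loop_post pot) => //.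
  by move=> [[K L] M] /stepP.
exact: search_inv0.
Qed.

End SearchLoop.

(** * Chordless paths *)

Section Thin.
Variables (V : finType) (S : {set V}).

(* Sequences here start outside [S] and alternate between [S] and its
   complement. [thin] runs through the alternating sequence [v :: p] and cuts
   short from an element [v] outside [S] whenever [v] has a neighbour in the
   sequence further away than the next element. *)
Fixpoint thin (in1 : bool) (v : V) (p : seq V) : query_alg V (seq V) :=
  if p is u :: w :: t then
    bind (hit S in1 v [set x in t | x \in S]) (fun b =>
      if b then thin in1 v t
      else bind (thin in1 w t) (fun q => Return V [:: u, w & q]))
  else Return V [::].

Variables (M1 M2 : matroid V).
Local Notation swap := (swap S M1 M2).

(** For [in1 = false] this is a path in the direction of the exchange graph, for [in1 = true] a path
    read backwards. *)
Fixpoint alternating (in1 : bool) (v : V) (p : seq V) : bool :=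
  match p with
  | [::] => v \notin S
  | u :: w :: t => [&& v \notin S, u \in S, swap in1 v u, swap (~~ in1) w u
                     & alternating in1 w t]
  | _ => false
  end.

(** [head_clean] excludes chords from an element outside [S] to a later one in [S], and [tail_clean]
    those from an element of [S] to a later one outside. The two kinds are treated by separate
    passes. *)
Fixpoint head_clean (in1 : bool) (v : V) (p : seq V) : bool :=
  if p is u :: w :: t then
    all (fun x => (x \in S) ==> ~~ swap in1 v x) t && head_clean in1 w t
  else true.

Fixpoint tail_clean (in1 : bool) (p : seq V) : bool :=
  if p is u :: w :: t then
    all (fun y => (y \notin S) ==> ~~ swap in1 y u) t && tail_clean in1 t
  else true.

Lemma pair_ind (P : seq V -> Prop) : P [::] -> (forall u, P [:: u]) ->
  (forall u w t, P t -> P [:: u, w & t]) -> forall p, P p.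
Proof.
move=> P0 P1 P2 p; have [n] := ubnP (size p).
elim: n p => // n IH [|u [|w t]] //= lt; apply: P2; apply: IH; lia.
Qed.

Lemma alternating_head in1 v p : alternating in1 v p -> v \notin S.
Proof. by case: p => [|u [|w t]] //= /andP[]. Qed.

Lemma queries_thin in1 v p : queries M1 M2 (thin in1 v p) <= size p.
Proof.
elim/pair_ind: p v => //= u w t IH v; rewrite queries_bind.
have le1 := queries_hit S M1 M2 in1 v [set x in t | x \in S].
case: ifP => _; first by apply: leq_add le1 (leqW (IH v)).
by rewrite queries_bind addn0; apply: leq_add le1 (leqW (IH w)).
Qed.

Lemma subseq_thin in1 v p : subseq (run M1 M2 (thin in1 v p)) p.
Proof.
elim/pair_ind: p v => [//|//|u w t IH v].
rewrite [thin _ _ _]/= run_bind; case: ifP => _.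
  apply: subseq_trans (IH v) _; exact: (suffix_subseq [:: u; w]).
by rewrite run_bind /= !eqxx.
Qed.

(** Thinning only deletes elements, so what the first pass achieved survives the second. *)
Lemma tail_clean_thin in1 in2 v p :
  tail_clean in1 p -> tail_clean in1 (run M1 M2 (thin in2 v p)).
Proof.
elim/pair_ind: p v => //= u w t IH v /andP[/allP ut tt]; rewrite run_bind.
case: ifP => _; first exact: IH.
rewrite run_bind /= IH // andbT; apply/allP=> y /(mem_subseq (subseq_thin _ _ _)).
exact: ut.
Qed.

Hypothesis S12 : common_indep M1 M2 S.

Lemma thinP in1 v p : alternating in1 v p ->
  let q := run M1 M2 (thin in1 v p) in
  [/\ alternating in1 v q, head_clean in1 v q & last v q = last v p].
Proof.
(* After a cut [v] need not be adjacent to the next element, only to some later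
   one. *)
pose weak v p := if p is u :: w :: t then
    [&& v \notin S, u \in S, has (fun x => (x \in S) && swap in1 v x) p,
        swap (~~ in1) w u & alternating in1 w t]
  else alternating in1 v p.
suff main q w : weak w q -> let q' := run M1 M2 (thin in1 w q) in
    [/\ alternating in1 w q', head_clean in1 w q' & last w q' = last w q].
  move=> alt; apply: main; case: p alt => [|u [|w t]] //=.
  by case/and5P=> -> -> -> -> ->.
elim/pair_ind: q w => {v p} [|u|u w t IH] v //=.
case/and5P=> vS uS vp wu alt; have wS := alternating_head alt.
rewrite run_bind (run_hit S12) //; last by apply/subsetP=> x; rewrite inE => /andP[].
case: ifP => [/existsP[x /andP[]]|/negbT/existsPn noh].
  rewrite inE => /andP[xt xS] vx; have [] := IH v.
    have hast : has (fun x => (x \in S) && swap in1 v x) t.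
      by apply/hasP; exists x; rewrite ?xS.
    case: t alt hast {IH vp x xt xS vx} => [|u' [|w' t']] //=.
    by case/and5P=> _ -> _ -> -> ->; rewrite vS.
  move=> -> -> ->; split=> //.
  by case: t xt {IH alt vp}.
have {}noh x : x \in t -> x \in S -> ~~ swap in1 v x.
  by move=> xt xS; have := noh x; rewrite inE xt xS.
(* The neighbour provided by [vp] is not [w], which lies outside [S], nor in [t], by the failed
   test; so it is [u]. *)
have {}vp : swap in1 v u.
  case/or3P: vp => [/andP[]//|/andP[wS']|/hasP[x xt /andP[xS vx]]].
    by rewrite wS' in wS.
  by have := noh x xt xS; rewrite vx.
rewrite run_bind /=; have [] := IH w.
  case: t alt {IH noh} => [|u' [|w' t']] //=.
  by case/and5P=> -> -> -> -> ->.
move=> -> -> ->; rewrite vS uS vp wu !andbT; split=> //.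
apply/allP=> x /(mem_subseq (subseq_thin _ _ _)) xt; apply/implyP; exact: noh.
Qed.

(** [acc] is the part already reversed. Clean heads of the original become clean tails of the
    reversal; the last hypothesis excludes chords between [p] and [acc]. *)
Lemma alternating_rev in1 v p acc :
  alternating in1 v p -> head_clean in1 v p ->
  alternating (~~ in1) v acc -> tail_clean in1 acc ->
  (forall x y, x \in p -> x \in S -> y \in acc -> y \notin S -> ~~ swap in1 y x) ->
  exists q, [/\ catrev p (v :: acc) = last v p :: q,
    alternating (~~ in1) (last v p) q & tail_clean in1 q].
Proof.
elim/pair_ind: p v acc => [|u|u w t IH] v acc //=; first by exists acc.
case/and5P=> vS uS vu wu alt /andP[/allP vt ht] alta ta cross.
apply: IH => //=.
- by rewrite (alternating_head alt) uS wu negbK vu alta.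
- rewrite ta andbT; apply/allP=> y ya; apply/implyP=> yS.
  by apply: cross => //; rewrite inE eqxx.
- move=> x y xt xS; rewrite !inE => /or3P[/eqP->|/eqP->|ya] yS.
  + by rewrite uS in yS.
  + exact: implyP (vt x xt) xS.
  + by apply: cross => //; rewrite !inE xt !orbT.
Qed.

End Thin.

Section Chordless.
Variables (T : eqType) (e : rel T).

Fixpoint chordless (x : T) (p : seq T) : bool :=
  if p is y :: p' then all (fun z => ~~ e x z) p' && chordless y p' else true.

(** A path along a subsequence must always take the next element, since an edge to a later one is a
    chord; by uniqueness it cannot stop before the end. *)
Lemma chordless_subseq x p q : path e x q -> chordless x p -> uniq (x :: p) ->
  subseq q p -> last x q = last x p -> q = p.
Proof.
elim: p x q => [|y p IH] x q /= xq; first by move=> _ _ /eqP.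
move=> /andP[/allP xp ch] /and3P[xyp yp up].
case: q xq => [|z q] /=.
  by move=> _ _ eqx; rewrite eqx mem_last in xyp.
case/andP=> xz zq; case: eqP => [zy|_] sub eql.
  by rewrite zy in zq eql *; rewrite (IH y q) //= yp.
have zp : z \in p by apply: (mem_subseq sub); rewrite mem_head.
by have := xp z zp; rewrite xz.
Qed.

End Chordless.

(** * From known edges to an augmenting path *)

Section AugmentingPath.
Variables (V : finType) (M1 M2 : matroid V) (S A Z : {set V}).
Hypothesis S12 : common_indep M1 M2 S.
Hypothesis defA : A = [set v | (v \notin S) && (v |: S \in indep M1)].
Hypothesis defZ : Z = [set v | (v \notin S) && (v |: S \in indep M2)].

Local Notation edge := (exchange_edge M1 M2 S).
Local Notation redge := (fun x y => edge y x).
Local Notation inV := (@inl V bool).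
Local Notation alternating := (alternating S M1 M2).
Local Notation head_clean := (head_clean S M1 M2).
Local Notation tail_clean := (tail_clean S M1 M2).

Lemma redge_path v p : alternating true v p -> last v p \in A ->
  path redge (inl v) (rcons (map inl p) (src V)).
Proof.
elim/pair_ind: p v => [v /= vS|//|u w t IH v /=].
  by rewrite defA inE => ->.
case/and5P=> vS uS vu wu alt /(IH _ alt) ->.
rewrite /swap /= in vu wu.
by rewrite uS vS vu (alternating_head alt) wu /= orbT.
Qed.

(** The exchange graph is bipartite on [V], so the two clean conditions cover all chords within the
    sequence; chords to [src] are excluded because only the last element is in [A]. *)
Lemma redge_chordless v p :
  alternating true v p -> head_clean true v p -> tail_clean false p ->
  uniq (v :: p) -> {in v :: p, forall y, y \in A -> y = last v p} ->
  chordless redge (inl v) (rcons (map inl p) (src V)).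
Proof.
elim/pair_ind: p v => [//|//|u w t IH v].
rewrite [alternating _ _ _]/= [head_clean _ _ _]/= [tail_clean _ _]/=.
case/and5P=> vS uS vu wu alt /andP[/allP hc hct] /andP[/allP tc tct] Uv onlyA.
have wS := alternating_head alt.
have vA : v \notin A.
  apply/negP=> /(onlyA v (mem_head _ _)) /= vl; move: Uv => /= /and3P[].
  by rewrite vl in_cons mem_last orbT.
rewrite /= (negPf wS) (negPf vS) /=; apply/and3P; split.
- apply/allP=> x; rewrite mem_rcons inE => /orP[/eqP->|/mapP[y yt ->]] /=.
    by move: vA; rewrite defA inE vS.
  rewrite (negPf vS) /= andbF orbF; apply/negP=> /andP[yS].
  by move: (hc y yt); rewrite yS => /negP.
- apply/allP=> x; rewrite mem_rcons inE => /orP[/eqP->|/mapP[y yt ->]] /=.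
    by rewrite uS.
  rewrite uS /= andbF /=; apply/negP=> /andP[yS].
  by move: (tc y yt); rewrite yS => /negP.
apply: IH => //; first by case/and3P: Uv.
by move=> y yt; apply: onlyA; rewrite !inE in yt *; rewrite yt !orbT.
Qed.

(** The second thinning leaves the path in reverse, so chordlessness is shown for the reversed edges
    and carried over by [rev]. The last hypothesis excludes chords at the sink. *)
Lemma augmenting_rev z p :
  alternating true z p -> head_clean true z p -> tail_clean false p ->
  uniq (z :: p) -> last z p \in A -> z \in Z ->
  {in z :: p, forall y, y \in A -> y = last z p} ->
  {in p, forall y, y \notin Z} ->
  augmenting_path M1 M2 S (rev (rcons (snk V :: map inl (z :: p)) (src V))).
Proof.
move=> alt hc tc Uz aA zZ onlyA noZ.
set X := map inl (z :: p).
have UX : uniq (snk V :: rcons X (src V)).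
  have notX b : (inr b : vertex V) \notin X by apply/negP=> /mapP[].
  rewrite cons_uniq mem_rcons in_cons negb_or !notX rcons_uniq notX.
  by rewrite map_inj_uniq // => ? ? [].
have pathX : path redge (snk V) (rcons X (src V)).
  rewrite /= redge_path // andbT.
  by move: zZ; rewrite defZ inE.
have chX : chordless redge (snk V) (rcons X (src V)).
  rewrite /= redge_chordless // andbT.
  apply/allP=> x; rewrite mem_rcons inE => /orP[/eqP-> //|/mapP[y yp ->]] /=.
  by have := noZ y yp; rewrite defZ inE.
split.
  rewrite rev_rcons /st_path eqxx; apply/and4P; split=> //.
  - by rewrite rev_cons last_rcons.
  - by rewrite -rev_rcons rev_uniq.
  - have := rev_path edge (snk V) (rcons X (src V)).
    by rewrite last_rcons belast_rcons => ->.
move=> [|s q] //; set P := rev _ => sub neP; apply/negP=> /and4P[/eqP eqs /eqP eql _ pq].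
rewrite {s}eqs in sub neP eql pq.
have revq : rev (src V :: q) = snk V :: rev (belast (src V) q).
  by rewrite lastI rev_rcons eql.
case/eqP: neP; apply: (can_inj revK); rewrite revq /P revK /=; congr (_ :: _).
apply: chordless_subseq chX _ _ _ => //.
- by have := rev_path redge (src V) q; rewrite eql => ->.
- by move: sub; rewrite -subseq_rev revq /P revK /= ?eqxx.
- rewrite last_rcons; have := congr1 (last (src V)) revq.
  by rewrite rev_cons last_rcons => /esym.
Qed.

(* The two calls of [thin] remove the chords leaving the complement of [S], then,
   along the reversed path, those entering it. *)
Definition shortcut (a : V) (p : seq V) : query_alg V (outcome V) :=
  bind (thin S false a p) (fun q =>
    if rev (a :: q) is z :: r then
      bind (thin S true z r) (fun t =>
        Return V (Augment (rev (rcons (snk V :: map inl (z :: t)) (src V)))))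
    else Return V (IsMaximum V)).

Lemma queries_shortcut a p : queries M1 M2 (shortcut a p) <= 2 * size p.
Proof.
rewrite queries_bind mul2n -addnn leq_add ?queries_thin //.
case rq : (rev _) => [|z r] //=; rewrite queries_bind addn0.
apply: leq_trans (queries_thin _ _ _ _ _ _) _.
have := size_subseq (subseq_thin S M1 M2 false a p).
by have := congr1 size rq; rewrite size_rev /= => -[->].
Qed.

(** Both passes keep the endpoints and otherwise only delete, so [a] remains the only element in [A]
    and the last one the only element in [Z]. *)
Lemma shortcutP a p : alternating false a p -> uniq (a :: p) ->
  a \in A -> last a p \in Z ->
  {in p, forall y, y \notin A} -> {in belast a p, forall y, y \notin Z} ->
  correct_outcome M1 M2 S (run M1 M2 (shortcut a p)).
Proof.
move=> alt Up aA zZ noA noZ; rewrite run_bind.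
have sub_q := subseq_thin S M1 M2 false a p.
have [alt_q hc_q last_q] := thinP S12 alt; set q := run _ _ _ in sub_q alt_q hc_q last_q *.
have [|//|//|r [revq alt_r tc_r]] := alternating_rev (acc := [::]) alt_q hc_q.
  by rewrite /= (alternating_head alt).
have {}revq : rev (a :: q) = last a p :: r by rewrite -last_q -revq.
rewrite last_q in alt_r; rewrite revq run_bind /=.
have sub_t := subseq_thin S M1 M2 true (last a p) r.
have := tail_clean_thin true (last a p) tc_r.
have [] := thinP S12 alt_r; set t := run _ _ _ in sub_t *.
move=> alt_t hc_t last_t tc_t.
have last_r : last (last a p) r = a.
  by have := congr1 (last a) revq; rewrite rev_cons last_rcons.
have mem_t y : y \in last a p :: t -> y \in a :: p.
  have : subseq (last a p :: t) (last a p :: r) by rewrite /= eqxx.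
  move=> /mem_subseq sub /sub; rewrite -revq mem_rev !inE => /orP[->//|].
  by move/(mem_subseq sub_q) => ->; rewrite orbT.
have Ut : uniq (last a p :: t).
  apply: (@subseq_uniq _ _ (last a p :: r)); first by rewrite /= eqxx.
  rewrite -revq rev_uniq; apply: subseq_uniq Up.
  by rewrite /= eqxx.
apply: augmenting_rev => //.
- by rewrite last_t last_r.
- move=> y /mem_t; rewrite last_t last_r inE => /orP[/eqP//|yp] yA.
  by move: (noA y yp); rewrite yA.
- move=> y yt; have := mem_t y; rewrite inE yt orbT => /(_ isT).
  rewrite lastI mem_rcons inE => /orP[/eqP yz|/noZ//].
  by move: Ut; rewrite /= -yz yt.
Qed.

Lemma sound_path K a p : sound S A Z M1 M2 K -> path (known K) a p ->
  a \notin S -> last a p \notin S ->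
  [/\ alternating false a p, {in p, forall y, y \notin A}
    & {in belast a p, forall y, y \notin Z}].
Proof.
move=> soundK; elim/pair_ind: p a => [a|u a|u w t IH a] /=.
- by move=> _ aS _; split.
- rewrite andbT => /soundK /orP[/and3P[->]//|/and4P[_ _ uS _] _].
  by rewrite uS.
case/and3P=> /soundK au /soundK uw wt aS lS.
have {au}/and4P[_ aZ uS au] : [&& a \notin S, a \notin Z, u \in S & swap S M1 M2 false a u].
  by move: au; rewrite (negPf aS).
have {uw}/and4P[_ wS wA uw] : [&& u \in S, w \notin S, w \notin A & swap S M1 M2 true w u].
  by move: uw; rewrite uS /= orbF.
have [alt noA noZ] := IH w wt wS lS; rewrite aS uS au uw alt; split=> //.
  move=> y; rewrite !inE => /or3P[/eqP->|/eqP->//|/noA//].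
  by rewrite defA inE uS.
move=> y; rewrite !inE => /or3P[/eqP->//|/eqP->|/noZ//].
by rewrite defZ inE uS.
Qed.

Lemma uniq_pathP (K : {set V * V}) a z :
  reflect (exists p, [&& path (known K) a p, last a p == z & uniq (a :: p)])
          (connect (known K) a z).
Proof.
apply: (iffP connectP) => [[p ap ->]|[p /and3P[ap /eqP <- _]]]; last by exists p.
by case/shortenP: ap => q aq Uq _; exists q; rewrite aq Uq eqxx.
Qed.

(** The path is chosen from recorded edges, so finding it costs no queries. *)
Definition known_path (K : {set V * V}) (a z : V) : seq V :=
  if uniq_pathP K a z is ReflectT ex then xchoose ex else [::].

Definition augment (K : {set V * V}) : query_alg V (outcome V) :=
  if [pick az : V * V | [&& az.1 \in A, az.2 \in Z & connect (known K) az.1 az.2]]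
    is Some az then shortcut az.1 (known_path K az.1 az.2)
  else Return V (IsMaximum V).

Lemma known_pathP K a z : connect (known K) a z ->
  [/\ path (known K) a (known_path K a z), last a (known_path K a z) = z
    & uniq (a :: known_path K a z)].
Proof.
rewrite /known_path; case: uniq_pathP => // ex _.
by have /and3P[? /eqP ? ?] := xchooseP ex.
Qed.

Lemma augmentP K : sound S A Z M1 M2 K -> hits_sink A Z K ->
  correct_outcome M1 M2 S (run M1 M2 (augment K)) /\
  queries M1 M2 (augment K) <= 2 * #|V|.
Proof.
move=> soundK /existsP[z /andP[zZ]]; rewrite reachE => /existsP[a /andP[aA az]].
rewrite /augment; case: pickP => [[{aA az}a {zZ}z] /= /and3P[aA zZ az]|/(_ (a, z))]; last first.
  by rewrite /= aA zZ az.
have [path_p last_p Up] := known_pathP az.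
have aS : a \notin S by move: aA; rewrite defA inE => /andP[].
have zS : z \notin S by move: zZ; rewrite defZ inE => /andP[].
have [||alt noA noZ] := sound_path soundK path_p; rewrite ?last_p //.
split; first by apply: shortcutP; rewrite ?last_p.
apply: leq_trans (queries_shortcut _ _) _; rewrite leq_mul2l /=.
by apply: ltnW; rewrite -[_.+1]/(size (a :: _)) -(card_uniqP Up) max_card.
Qed.

End AugmentingPath.

(** * The number of queries *)

(** The cube root rounded up for positive [r]; its value at 0 is 1, which keeps [h] positive. *)
Definition cbrt_up (r : nat) : nat := (\max_(i < r | i ^ 3 < r) i).+1.

Lemma cbrt_up_ge r : r <= cbrt_up r ^ 3.
Proof.
rewrite leqNgt; apply/negP=> lt.
have ltr : cbrt_up r < r.
  by apply: leq_ltn_trans lt; rewrite -[X in X <= _]expn1 leq_pexp2l.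
by have := @leq_bigmax_cond _ (fun i : 'I_r => i ^ 3 < r) (fun i => i : nat) (Ordinal ltr) lt;
  rewrite ltnn.
Qed.

Lemma cbrt_up_lt r : 0 < r -> (cbrt_up r).-1 ^ 3 < r.
Proof.
move=> r_gt0; rewrite /cbrt_up /=.
by elim/big_ind: _ => // x y; rewrite /maxn; case: ifP.
Qed.

(** The successor in [tau] makes [tau * h] exceed [#|V|], and [k] is chosen so that [2 ^ k] is at
    least [#|S|]. *)
Definition algorithm (V : finType) (S : {set V}) : query_alg V (outcome V) :=
  let h := cbrt_up #|S| in
  let tau := (#|V| %/ h).+1 in
  let k := up_log 2 #|S| in
  bind (select (fun v => Query1 (v |: S) (fun b => Return V b)) (enum (~: S))) (fun sA =>
  bind (select (fun v => Query2 (v |: S) (fun b => Return V b)) (enum (~: S))) (fun sZ =>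
  let A := [set v in sA] in
  let Z := [set v in sZ] in
  bind (search S A Z h tau k) (fun o =>
  if o is Some K then augment S A Z K else Return V (IsMaximum V)))).

(** The constant is 3 + 3 + 1 + 2 + 2: completions, newly reached elements, deficit, reserved rounds
    and the current round. The second and the fourth use that [#|S|] is at most [h ^ 3]. *)
Lemma pot_init (V : finType) (S A Z : {set V}) (h k : nat) :
  0 < h -> #|S| <= h ^ 3 ->
  pot S A Z h (#|V| %/ h).+1 k (set0, Z, set0) <= 11 * (#|V| * (h * h) * k.+1).
Proof.
move=> h_gt0 leh; rewrite /pot /work.
have lph := phase_le S A Z h k set0 Z set0.
have leC (X : {set V}) : #|X| <= #|V| by apply: max_card.
have le_round : round_cost S k <= 2 * (#|V| * k.+1).
  rewrite /round_cost mul2n -addnn leq_add //; first by rewrite (leq_trans (leC _)) ?leq_pmulr.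
  by rewrite mulnC leq_mul2r leC orbT.
have hh_gt0 : 0 < h * h by rewrite muln_gt0 h_gt0.
have le1 : #|~: S :\: Z| * (h * h).+2 <= 3 * (#|V| * (h * h) * k.+1).
  apply: (@leq_trans (#|V| * (3 * (h * h)))).
    by apply: leq_mul => //; rewrite mulSn mul2n -addnn; lia.
  by rewrite mulnCA leq_mul2l leq_pmulr.
have leF : #|S :\: reach A set0| <= #|S| by rewrite subset_leq_card ?subsetDl.
have le2 : #|S :\: reach A set0| * (k.+1 * (#|V| %/ h).+2) <= 3 * (#|V| * (h * h) * k.+1).
  rewrite mulnCA [k.+1 * _]mulnC mulnA leq_mul2r; apply/orP; right.
  rewrite -addn2 mulnDr (_ : 3 * _ = #|V| * (h * h) + #|V| * (h * h) * 2); last by lia.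
  apply: leq_add; last first.
    by rewrite leq_mul2r (leq_trans (leC _)) ?leq_pmulr // orbT.
  apply: (@leq_trans (h ^ 3 * (#|V| %/ h))).
    by rewrite leq_mul2r (leq_trans leF) ?orbT.
  have cube q : h ^ 3 * q = q * h * (h * h) by rewrite !expnS expn0 muln1; clear; lia.
  by rewrite cube leq_mul2r leq_trunc_div orbT.
have le3 : k.+1 * deficit S A h set0 Z <= #|V| * (h * h) * k.+1.
  rewrite mulnC leq_mul2r /=; apply: (@leq_trans (#|V| * h)).
    apply: (@leq_trans (\sum_(v in ~: S :\: Z) h)).
      by apply: leq_sum => v _; apply: leq_subr.
    by rewrite sum_nat_const leq_mul2r leC orbT.
  by rewrite leq_mul2l leq_pmulr ?orbT.
have le4 : round_cost S k * (#|S :\: reach A set0| %/ h) <= 2 * (#|V| * (h * h) * k.+1).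
  rewrite mulnAC mulnA; apply: leq_mul => //.
  apply: (@leq_trans (h ^ 3 %/ h)); first by rewrite leq_div2r // (leq_trans leF).
  by rewrite expnS mulKn // -mulnn.
have le5 : round_cost S k <= 2 * (#|V| * (h * h) * k.+1).
  by apply: leq_trans le_round _; rewrite leq_mul2l /= mulnAC leq_pmulr.
move: le1 le2 le3 le4 (leq_trans lph le5); clear.
by move: (#|_| * _) (#|_| * _) (k.+1 * _) (round_cost _ _ * _) (phase _ _ _ _ _ _ _ _); lia.
Qed.

Lemma algorithmP (V : finType) (M1 M2 : matroid V) (S : {set V}) :
  common_indep M1 M2 S ->
  correct_outcome M1 M2 S (run M1 M2 (algorithm S)) /\
  queries M1 M2 (algorithm S) <=
    15 * (#|V| * (cbrt_up #|S| * cbrt_up #|S|) * (up_log 2 #|S|).+1).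
Proof.
move=> S12; rewrite /algorithm.
set h := cbrt_up _; set k := up_log _ _; set tau := (_ %/ h).+1.
have leS : size (enum (~: S)) <= #|V| by rewrite -cardE max_card.
have le_sel q : (forall v, queries M1 M2 (q v) <= 1) ->
    queries M1 M2 (select q (enum (~: S))) <= #|V|.
  by move=> q1; apply: leq_trans (queries_select _ q1) leS.
rewrite run_bind queries_bind run_select run_bind queries_bind run_select.
set sA := filter _ _; set sZ := filter _ _.
set A := [set v in sA]; set Z := [set v in sZ]; rewrite run_bind queries_bind.
have defA : A = [set v | (v \notin S) && (v |: S \in indep M1)].
  by apply/setP=> v; rewrite !inE mem_filter mem_enum inE andbC.
have defZ : Z = [set v | (v \notin S) && (v |: S \in indep M2)].
  by apply/setP=> v; rewrite !inE mem_filter mem_enum inE andbC.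
have h_gt0 : 0 < h by [].
have leh : #|S| <= h ^ 3 by apply: cbrt_up_ge.
have le_tau : #|~: S| <= tau * h.
  by apply: leq_trans (max_card _) (ltnW _); rewrite ltn_ceil.
have lek : #|S| <= 2 ^ k by apply: up_logP.
have [post cost] := searchP S12 defA defZ h_gt0 (ltn0Sn _) le_tau lek.
have init := pot_init A Z k h_gt0 leh.
have hk : #|V| <= #|V| * (h * h) * k.+1 by rewrite -mulnA leq_pmulr // !muln_gt0 h_gt0.
have le_A := le_sel (fun v => Query1 (v |: S) (fun b => Return V b)) (fun=> leqnn 1).
have le_Z := le_sel (fun v => Query2 (v |: S) (fun b => Return V b)) (fun=> leqnn 1).
have [res le_res] :
    let c := if run M1 M2 (search S A Z h tau k) is Some K then augment S A Z K
             else Return V (IsMaximum V) in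
    correct_outcome M1 M2 S (run M1 M2 c) /\ queries M1 M2 c <= 2 * #|V|.
  case: (run M1 M2 (search _ _ _ _ _ _)) post => [K [soundK sinkK]|maxS] //=.
  exact (augmentP S12 defA defZ soundK sinkK).
(* One unit each for computing [A] and [Z], 11 for the search and 2 for extracting the path. *)
split=> //; rewrite (_ : 15 * _ = #|V| * (h * h) * k.+1 + (#|V| * (h * h) * k.+1 +
  (11 * (#|V| * (h * h) * k.+1) + 2 * (#|V| * (h * h) * k.+1)))); last by clear; lia.
apply: leq_add; first exact: leq_trans le_A hk.
apply: leq_add; first exact: leq_trans le_Z hk.
apply: leq_add; first exact: leq_trans cost init.
by apply: leq_trans le_res _; rewrite leq_mul2l.
Qed.

Local Open Scope ring_scope.
Import Order.TTheory GRing.Theory Num.Theory.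

(** Rounding up adds at most 1, which is at most the cube root itself as [r] is positive; squaring
    the factor 2 gives 4. *)
Lemma cbrt_up_powR (R : realType) (r : nat) : (0 < r)%N ->
  (cbrt_up r * cbrt_up r)%:R <= 4 * r%:R `^ (2 / 3) :> R.
Proof.
move=> r_gt0; have r1 : 1 <= r%:R :> R by rewrite ler1n.
have root_ge1 : 1 <= r%:R `^ (3^-1) :> R.
  by rewrite -[X in X <= _](powRr0 r%:R) ler_powR // invr_ge0.
have le2 : (cbrt_up r)%:R <= 2 * r%:R `^ (3^-1) :> R.
  rewrite -(prednK (isT : (0 < cbrt_up r)%N)) -natr1 mulr_natl mulr2n lerD //.
  set m := (cbrt_up r).-1.
  have -> : m%:R = (m%:R ^+ 3) `^ 3^-1 :> R.
    by rewrite -powR_mulrn // -powRrM mulfV ?powRr1 ?ler0n ?pnatr_eq0.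
  by rewrite ge0_ler_powR ?nnegrE ?exprn_ge0 ?invr_ge0 // -natrX ler_nat ltnW ?cbrt_up_lt.
rewrite natrM; apply: le_trans (ler_pM _ _ le2 le2) _ => //.
rewrite mulrACA -natrM -powRD; last by rewrite pnatr_eq0 -lt0n r_gt0 implybT.
by rewrite (_ : 3^-1 + 3^-1 = 2 / 3 :> R) // mulrDl mul1r.
Qed.

(** With [k] the rounded logarithm, [2 ^ k.-1 < r] bounds [k.-1] copies of [ln 2] by one [ln r], and
    the other two copies are at most [ln r] each. *)
Lemma up_log_ln (R : realType) (r : nat) : (1 < r)%N ->
  (up_log 2 r).+1%:R * ln 2 <= 3 * ln r%:R :> R.
Proof.
move=> r_gt1; have /andP[lt _] := up_log_bounds (isT : (1 < 2)%N) r_gt1.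
have k_gt0 : (0 < up_log 2 r)%N by rewrite up_log_gt0.
rewrite -(prednK k_gt0) -addn2 natrD mulrDl (_ : 3 = 1 + 2 :> R); last by rewrite nat1r.
rewrite [X in _ <= X]mulrDl mul1r lerD //; last first.
  by rewrite ler_pM2l ?ltr0n // ler_ln ?posrE ?ler_nat ?ltr0n // ltnW.
rewrite mulr_natl -lnXn ?ltr0n // ler_ln ?posrE ?exprn_gt0 ?ltr0n ?(ltnW r_gt1) //.
by rewrite -natrX ler_nat ltnW.
Qed.

(* log r vanishes at r = 1 (and r = 0), where the literal bound would be 0;
   there the bound O(n) is stated instead. *)
Theorem theorem3p2 (R : realType) :
  exists (alg : forall V : finType, {set V} -> query_alg V (outcome V)) (C : R),
  forall (V : finType) (M1 M2 : matroid V) (S : {set V}),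
    common_indep M1 M2 S ->
    let n := #|V| in
    let r := #|S| in
    let cost := queries M1 M2 (alg V S) in
    [/\ correct_outcome M1 M2 S (run M1 M2 (alg V S)),
        (2 <= r)%N -> cost%:R <= C * (n%:R * (r%:R `^ (2 / 3) * ln r%:R))
      & (r <= 1)%N -> cost%:R <= C * n%:R].
Proof.
(* Here 180 is 15 * 4 * 3, with 4 from [cbrt_up_powR] and 3 from [up_log_ln], and [ln 2] converts
   the binary logarithm; the summand 15 serves the case [r <= 1]. *)
exists algorithm, (180 / ln 2 + 15) => V M1 M2 S S12 n r cost.
have [res le_cost] := algorithmP S12; rewrite -/n -/r -/cost in le_cost.
have ln2_gt0 : 0 < ln 2 :> R by rewrite ln_gt0 // ltr1n.
split=> // [r_ge2|r_le1].
- have r_gt0 : (0 < r)%N by apply: ltnW.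
  have lnr_ge0 : 0 <= ln r%:R :> R by rewrite ln_ge0 // ler1n.
  apply: (@le_trans _ _ (15 * (n%:R * (4 * r%:R `^ (2 / 3)) * (3 * ln r%:R / ln 2)))).
    apply: (@le_trans _ _ (15 * (n * (cbrt_up r * cbrt_up r) * (up_log 2 r).+1))%:R).
      by rewrite ler_nat.
    rewrite natrM ler_pM2l ?ltr0n // natrM ler_pM // ?natrM.
      by rewrite ler_wpM2l // -natrM cbrt_up_powR.
    by rewrite ler_pdivlMr // up_log_ln.
  have -> : 15 * (n%:R * (4 * r%:R `^ (2 / 3)) * (3 * ln r%:R / ln 2)) =
            180 / ln 2 * (n%:R * (r%:R `^ (2 / 3) * ln r%:R)) :> R by ring.
  by rewrite [X in _ <= X]mulrDl lerDl !mulr_ge0 ?powR_ge0 ?ler0n.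
- have h1 : cbrt_up r = 1%N.
    rewrite /cbrt_up; congr _.+1; apply/eqP; rewrite -leqn0; apply/bigmax_leqP => i _.
    by have := ltn_ord i; clear -r_le1; lia.
  have k0 : up_log 2 r = 0%N by case: r r_le1 {h1 le_cost} => [|[|]].
  apply: (@le_trans _ _ (15 * n)%:R).
    by rewrite ler_nat; move: le_cost; rewrite h1 k0 !muln1.
  by rewrite natrM ler_wpM2r // lerDr divr_ge0 // ltW.
Qed.
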